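(* $\mathsf{CS4}$ has finitely many $\{\Box,\Diamond\}$-modalities, and $\mathsf{CS4}$ has finitely many $\{\neg,\Box\}$-modalities.
   Context: Fix a set $\mathrm{Prop}$ of propositional symbols. Modal formulas are given by the grammar $\varphi := \bot \mid p \mid \varphi\land\varphi \mid \varphi\lor\varphi \mid \varphi\to\varphi \mid \Box\varphi \mid \Diamond\varphi$ with $p\in\mathrm{Prop}$; $\Box$ and $\Diamond$ are not interdefinable. Put $\neg\varphi := \varphi\to\bot$. A relation is a preorder if it is reflexive and transitive. For a relation $R$ on $W$, a set $A\subseteq W$ is an $R$-upset iff $w\in A$ and $wRv$ imply $v\in A$. A birelational $\mathsf{CS4}$-model is a tuple $M=\langle W, W^\bot, \preceq, \sqsubseteq, V\rangle$ where $W$ is a set of worlds, $W^\bot\subseteq W$ is the set of fallible worlds, $\preceq$ and $\sqsubseteq$ are preorders on $W$, and $V:\mathrm{Prop}\to\mathcal{P}(W)$, such that: (i) $M$ is backward confluent: $w\sqsubseteq v\preceq v'$ implies there is $w'$ with $w\preceq w'$ and $w'\sqsubseteq v'$; (ii) for every $p\in\mathrm{Prop}$, $V(p)$ is a $\preceq$-upset and $W^\bot\subseteq V(p)$; (iii) $W^\bot$ is both a $\preceq$-upset and a $\sqsubseteq$-upset. Truth: $M,w\models p$ iff $w\in V(p)$; $M,w\models\bot$ iff $w\in W^\bot$; $\land,\lor$ are evaluated pointwise; $M,w\models\varphi\to\psi$ iff for all $v$ with $w\preceq v$, $M,v\models\varphi$ implies $M,v\models\psi$; $M,w\models\Box\varphi$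 iff for all $v,u$ with $w\preceq v$ and $v\sqsubseteq u$, $M,u\models\varphi$; $M,w\models\Diamond\varphi$ iff for all $v$ with $w\preceq v$ there is $u$ with $v\sqsubseteq u$ and $M,u\models\varphi$. Write $\|\varphi\|^M := \{w\in W\mid M,w\models\varphi\}$. For $X\subseteq\{\neg,\Box,\Diamond\}$, an $X$-modality is a finite (possibly empty) sequence $\sigma\in X^{<\omega}$; $\sigma\varphi$ denotes the formula obtained by prefixing $\sigma$ to $\varphi$. Modalities $\sigma,\tau$ are $\mathsf{CS4}$-equivalent if $\|\sigma\varphi\|^M=\|\tau\varphi\|^M$ for every $\mathsf{CS4}$-model $M$ and every formula $\varphi$. $\mathsf{CS4}$ has finitely many $X$-modalities iff there is a finite set $\Sigma\subseteq X^{<\omega}$ such that every $X$-modality is $\mathsf{CS4}$-equivalent to some $\sigma\in\Sigma$; otherwise it has infinitely many $X$-modalities. *)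

(* Defs.v *)
From Stdlib Require Export List Relations.
Export ListNotations.

Set Implicit Arguments.

Inductive formula (Atom : Type) : Type :=
| Bot : formula Atom
| Var : Atom -> formula Atom
| And : formula Atom -> formula Atom -> formula Atom
| Or  : formula Atom -> formula Atom -> formula Atom
| Imp : formula Atom -> formula Atom -> formula Atom
| Box : formula Atom -> formula Atom
| Dia : formula Atom -> formula Atom.

Arguments Bot {Atom}.

Definition Neg (Atom : Type) (phi : formula Atom) : formula Atom := Imp phi Bot.

Definition upset (W : Type) (R : relation W) (A : W -> Prop) : Prop :=
  forall w v : W, A w -> R w v -> A v.

(* [ile] is the intuitionistic preorder and [mle] the modal one.  The set of
   worlds may be empty. *)
Record cs4_model (Atom : Type) : Type := CS4Model {
  world : Type;
  fallible : world -> Prop;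
  ile : relation world;
  mle : relation world;
  val : Atom -> world -> Prop;
  ile_preorder : preorder world ile;
  mle_preorder : preorder world mle;
  backward_confluent : forall w v v' : world,
    mle w v -> ile v v' -> exists w' : world, ile w w' /\ mle w' v';
  val_upset : forall p : Atom, upset ile (val p);
  val_fallible : forall (p : Atom) (w : world), fallible w -> val p w;
  fallible_ile_upset : upset ile fallible;
  fallible_mle_upset : upset mle fallible
}.

Fixpoint sat (Atom : Type) (M : cs4_model Atom) (w : world M)
    (phi : formula Atom) : Prop :=
  match phi with
  | Bot => fallible M w
  | Var p => val M p w
  | And a b => sat M w a /\ sat M w b
  | Or a b => sat M w a \/ sat M w b
  | Imp a b => forall v : world M, ile M w v -> sat M v a -> sat M v b
  | Box a => forall v u : world M, ile M w v -> mle M v u -> sat M u a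
  | Dia a => forall v : world M, ile M w v ->
               exists u : world M, mle M v u /\ sat M u a
  end.

Definition truth_set (Atom : Type) (M : cs4_model Atom) (phi : formula Atom) :
    world M -> Prop :=
  fun w => sat M w phi.

Inductive modal_op : Set := OpNeg | OpBox | OpDia.

Definition apply_op (Atom : Type) (o : modal_op) (phi : formula Atom) :
    formula Atom :=
  match o with
  | OpNeg => Neg phi
  | OpBox => Box phi
  | OpDia => Dia phi
  end.

(* The head of the list is the outermost operator. *)
Definition modality : Set := list modal_op.

Definition prefix (Atom : Type) (s : modality) (phi : formula Atom) :
    formula Atom :=
  fold_right (@apply_op Atom) phi s.

Definition modality_over (X : modal_op -> Prop) (s : modality) : Prop :=
  Forall X s.

(* Equality of truth sets is extensional, as subsets of the worlds. *)
Definition cs4_equivalent (Atom : Type) (s t : modality) : Prop :=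
  forall (M : cs4_model Atom) (phi : formula Atom) (w : world M),
    truth_set M (prefix s phi) w <-> truth_set M (prefix t phi) w.

Definition finitely_many_modalities (Atom : Type) (X : modal_op -> Prop) : Prop :=
  exists Sigma : list modality,
    Forall (modality_over X) Sigma /\
    forall s : modality, modality_over X s ->
      exists t : modality, In t Sigma /\ cs4_equivalent Atom s t.

(* Main.v *)
Require Import Defs.

Set Implicit Arguments.

(** Order formulas by entailment in all models.  Persistence of truth along the
    intuitionistic preorder, together with backward confluence, makes [Box] an
    interior operator and [Dia] a closure operator for this order, while [Neg]
    is antitone with [a] below [Neg (Neg a)].  What remains is order theory in
    the style of Kuratowski's closure-complement theorem.

    For an interior operator [i] and a closure operator [c], both [i c] and
    [c i] are idempotent ([interior_closure_idem], [closure_interior_idem]).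
    With [i = Box] and [c = Dia] only the seven alternating words of length at
    most three survive.

    For negation and box, write [N] and [B].  Three consecutive [N] collapse to
    one, so in a reduced word the occurrences of [B] are separated by [N] or by
    [N N].  The double negation is a closure operator, and the laws
    [B N N B N = B N] and [N B N N B = N B] eliminate every inner [N N] except
    in the word [B N N B] itself.  Finally [x |-> B N x] is antitone, and its
    square is above the identity on open elements (those of the form [B y]), so
    its cube agrees with it there: [B N B N B N B = B N B].  Hence at most three
    boxes occur, and at most 31 words are left. *)

(** * Entailment and the three operators *)

Definition entails {Atom : Type} (a b : formula Atom) : Prop :=
  forall (M : cs4_model Atom) (w : world M), sat M w a -> sat M w b.

Definition interderivable {Atom : Type} (a b : formula Atom) : Prop :=
  entails a b /\ entails b a.

Lemma entails_refl (Atom : Type) (a : formula Atom) : entails a a.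
Proof. intros M w H; exact H. Qed.

Lemma entails_trans (Atom : Type) (a b c : formula Atom) :
  entails a b -> entails b c -> entails a c.
Proof. intros Hab Hbc M w H; apply Hbc, Hab, H. Qed.

Lemma ile_refl (Atom : Type) (M : cs4_model Atom) (w : world M) : ile M w w.
Proof. apply (preord_refl _ _ (ile_preorder M)). Qed.

Lemma ile_trans (Atom : Type) (M : cs4_model Atom) (u v w : world M) :
  ile M u v -> ile M v w -> ile M u w.
Proof. apply (preord_trans _ _ (ile_preorder M)). Qed.

Lemma mle_refl (Atom : Type) (M : cs4_model Atom) (w : world M) : mle M w w.
Proof. apply (preord_refl _ _ (mle_preorder M)). Qed.

Lemma mle_trans (Atom : Type) (M : cs4_model Atom) (u v w : world M) :
  mle M u v -> mle M v w -> mle M u w.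
Proof. apply (preord_trans _ _ (mle_preorder M)). Qed.

(** The clauses for implication, box and diamond quantify over all intuitionistic
    successors, so for them persistence is mere transitivity. *)
Lemma sat_persistent (Atom : Type) (M : cs4_model Atom) (phi : formula Atom) :
  upset (ile M) (fun w => sat M w phi).
Proof.
  induction phi as [|p|a IHa b IHb|a IHa b IHb|a IHa b IHb|a IHa|a IHa];
    intros w v H Hwv; simpl in *.
  - exact (fallible_ile_upset M _ _ H Hwv).
  - exact (val_upset M p _ _ H Hwv).
  - destruct H as [Ha Hb]; split; [eapply IHa | eapply IHb]; eassumption.
  - destruct H as [H|H]; [left; eapply IHa | right; eapply IHb]; eassumption.
  - intros u Hvu; apply H; eapply ile_trans; eassumption.
  - intros u t Hvu; apply H; eapply ile_trans; eassumption.
  - intros u Hvu; apply H; eapply ile_trans; eassumption.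
Qed.

Definition interior {Atom : Type} (i : formula Atom -> formula Atom) : Prop :=
  (forall a b, entails a b -> entails (i a) (i b)) /\
  (forall a, entails (i a) a) /\
  (forall a, entails (i a) (i (i a))).

Definition closure {Atom : Type} (c : formula Atom -> formula Atom) : Prop :=
  (forall a b, entails a b -> entails (c a) (c b)) /\
  (forall a, entails a (c a)) /\
  (forall a, entails (c (c a)) (c a)).

(** Backward confluence says that the composite of [ile] followed by [mle], over
    which [Box] quantifies, is transitive; this is idempotence. *)
Lemma interior_Box (Atom : Type) : interior (@Box Atom).
Proof.
  split; [|split].
  - intros a b Hab M w H v u Hwv Hvu; apply Hab; exact (H v u Hwv Hvu).
  - intros a M w H; exact (H w w (ile_refl M w) (mle_refl M w)).
  - intros a M w H v u Hwv Hvu u' t Huu' Hu't.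
    destruct (backward_confluent M _ _ _ Hvu Huu') as [v' [Hvv' Hv'u']].
    apply (H v' t); [eapply ile_trans | eapply mle_trans]; eassumption.
Qed.

Lemma closure_Dia (Atom : Type) : closure (@Dia Atom).
Proof.
  split; [|split].
  - intros a b Hab M w H v Hwv; destruct (H v Hwv) as [u [Hvu Hu]].
    exists u; split; [exact Hvu | apply Hab, Hu].
  - intros a M w H v Hwv; exists v; split; [apply mle_refl|].
    exact (sat_persistent M a _ _ H Hwv).
  - intros a M w H v Hwv; destruct (H v Hwv) as [u [Hvu Hu]].
    destruct (Hu u (ile_refl M u)) as [t [Hut Ht]].
    exists t; split; [eapply mle_trans; eassumption | exact Ht].
Qed.

Lemma Neg_antitone (Atom : Type) (a b : formula Atom) :
  entails a b -> entails (Neg b) (Neg a).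
Proof. intros Hab M w H v Hwv Ha; apply (H v Hwv), Hab, Ha. Qed.

Lemma Neg_Neg_inflationary (Atom : Type) (a : formula Atom) :
  entails a (Neg (Neg a)).
Proof.
  intros M w H v Hwv Hv; apply (Hv v (ile_refl M v)).
  exact (sat_persistent M a _ _ H Hwv).
Qed.

(** * Order-theoretic collapse laws *)

Lemma interior_closure_idem (Atom : Type) (i c : formula Atom -> formula Atom)
    (a : formula Atom) :
  interior i -> closure c -> interderivable (i (c (i (c a)))) (i (c a)).
Proof.
  intros [imono [idefl iidem]] [cmono [cinfl cidem]]; split.
  - apply imono; eapply entails_trans; [apply cmono, idefl | apply cidem].
  - eapply entails_trans; [apply iidem | apply imono, cinfl].
Qed.

Lemma closure_interior_idem (Atom : Type) (i c : formula Atom -> formula Atom)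
    (a : formula Atom) :
  interior i -> closure c -> interderivable (c (i (c (i a)))) (c (i a)).
Proof.
  intros [imono [idefl iidem]] [cmono [cinfl cidem]]; split.
  - eapply entails_trans; [apply cmono, idefl | apply cidem].
  - apply cmono; eapply entails_trans; [apply iidem | apply imono, cinfl].
Qed.

(** The triangle argument for an antitone Galois connection of [f] with itself.
    The two inequalities are asked for only at [a] and [f a], because for
    [f = Box o Neg] they hold on open elements only. *)
Lemma antitone_cube (Atom : Type) (f : formula Atom -> formula Atom)
    (a : formula Atom) :
  (forall b c, entails b c -> entails (f c) (f b)) ->
  entails a (f (f a)) -> entails (f a) (f (f (f a))) ->
  interderivable (f (f (f a))) (f a).
Proof. intros Hanti Ha Hfa; split; [apply Hanti, Ha | exact Hfa]. Qed.

Lemma Neg_cube (Atom : Type) (a : formula Atom) :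
  interderivable (Neg (Neg (Neg a))) (Neg a).
Proof.
  apply (antitone_cube (@Neg Atom)); [apply Neg_antitone | |];
    apply Neg_Neg_inflationary.
Qed.

Lemma closure_Neg_Neg (Atom : Type) : closure (fun a : formula Atom => Neg (Neg a)).
Proof.
  split; [|split].
  - intros a b Hab; apply Neg_antitone, Neg_antitone, Hab.
  - apply Neg_Neg_inflationary.
  - intros a; apply Neg_antitone, (proj2 (Neg_cube a)).
Qed.

(** On the open element [Box a], the operator [Box o Neg] acts as a
    pseudocomplement within the lattice of open elements. *)
Lemma Box_Neg_cube_open (Atom : Type) (a : formula Atom) :
  interderivable (Box (Neg (Box (Neg (Box (Neg (Box a))))))) (Box (Neg (Box a))).
Proof.
  destruct (interior_Box Atom) as [imono [idefl iidem]].
  assert (open_below : forall b : formula Atom,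
             entails (Box b) (Box (Neg (Box (Neg (Box b)))))).
  { intros b; eapply entails_trans; [apply iidem | apply imono].
    eapply entails_trans; [apply Neg_Neg_inflationary|].
    apply Neg_antitone, idefl. }
  apply (antitone_cube (fun b => Box (Neg b))).
  - intros b c Hbc; apply imono, Neg_antitone, Hbc.
  - apply open_below.
  - apply open_below.
Qed.

(** A negation is already closed under double negation, so it behaves like
    [Neg (Neg _)] in the idempotence law for [Box] and that closure. *)
Lemma Box_Neg_Neg_Box_Neg (Atom : Type) (a : formula Atom) :
  interderivable (Box (Neg (Neg (Box (Neg a))))) (Box (Neg a)).
Proof.
  destruct (interior_Box Atom) as [imono [idefl iidem]]; split.
  - apply imono; eapply entails_trans; [|apply (proj1 (Neg_cube a))].
    apply Neg_antitone, Neg_antitone, idefl.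
  - eapply entails_trans; [apply iidem | apply imono, Neg_Neg_inflationary].
Qed.

(** Negation does not distinguish a formula from its double negation, so it sees
    no difference between [Box a] and anything lying between the two. *)
Lemma Neg_Box_Neg_Neg_Box (Atom : Type) (a : formula Atom) :
  interderivable (Neg (Box (Neg (Neg (Box a))))) (Neg (Box a)).
Proof.
  destruct (interior_Box Atom) as [imono [idefl iidem]]; split.
  - apply Neg_antitone; eapply entails_trans;
      [apply iidem | apply imono, Neg_Neg_inflationary].
  - eapply entails_trans; [apply (proj2 (Neg_cube _))|].
    apply Neg_antitone, idefl.
Qed.

(** * Reduction of modalities *)

Lemma cs4_equivalent_of_interderivable (Atom : Type) (s t : modality) :
  (forall phi : formula Atom, interderivable (prefix s phi) (prefix t phi)) ->
  cs4_equivalent Atom s t.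
Proof.
  intros H M phi w; destruct (H phi) as [H1 H2].
  split; [apply H1 | apply H2].
Qed.

Lemma cs4_equivalent_cons (Atom : Type) (o : modal_op) (s t : modality) :
  cs4_equivalent Atom s t -> cs4_equivalent Atom (o :: s) (o :: t).
Proof.
  intros H; apply cs4_equivalent_of_interderivable; intros phi.
  assert (Hst : entails (prefix s phi) (prefix t phi)) by (intros M w; apply H).
  assert (Hts : entails (prefix t phi) (prefix s phi)) by (intros M w; apply H).
  destruct o; split; simpl.
  1, 2: apply Neg_antitone; assumption.
  1, 2: apply (interior_Box Atom); assumption.
  1, 2: apply (closure_Dia Atom); assumption.
Qed.

(** Since a modality is built by adding operators in front, closure under a single
    new outermost operator is enough, and reductions are only ever needed at the
    front of a word. *)
Lemma finitely_many_of_cons_closed (Atom : Type) (X : modal_op -> Prop)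
    (Sigma : list modality) :
  Forall (modality_over X) Sigma ->
  In [] Sigma ->
  (forall (o : modal_op) (t : modality), X o -> In t Sigma ->
     exists t', In t' Sigma /\ cs4_equivalent Atom (o :: t) t') ->
  finitely_many_modalities Atom X.
Proof.
  intros HX Hnil Hcons; exists Sigma; split; [exact HX|].
  intros s Hs; induction Hs as [|o s Ho Hs IH].
  - exists []; split; [exact Hnil | intros M phi w; reflexivity].
  - destruct IH as [t [Ht Hst]].
    destruct (Hcons o t Ho Ht) as [t' [Ht' Htt']].
    exists t'; split; [exact Ht'|].
    intros M phi w; etransitivity;
      [apply (cs4_equivalent_cons o Hst) | apply Htt'].
Qed.

Local Notation N := OpNeg.
Local Notation B := OpBox.
Local Notation D := OpDia.

Lemma reduce_BB (Atom : Type) (r : modality) :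
  cs4_equivalent Atom (B :: B :: r) (B :: r).
Proof.
  apply cs4_equivalent_of_interderivable; intros phi.
  split; apply (interior_Box Atom).
Qed.

Lemma reduce_DD (Atom : Type) (r : modality) :
  cs4_equivalent Atom (D :: D :: r) (D :: r).
Proof.
  apply cs4_equivalent_of_interderivable; intros phi.
  split; apply (closure_Dia Atom).
Qed.

Lemma reduce_BDBD (Atom : Type) (r : modality) :
  cs4_equivalent Atom (B :: D :: B :: D :: r) (B :: D :: r).
Proof.
  apply cs4_equivalent_of_interderivable; intros phi.
  exact (interior_closure_idem _ (interior_Box Atom) (closure_Dia Atom)).
Qed.

Lemma reduce_DBDB (Atom : Type) (r : modality) :
  cs4_equivalent Atom (D :: B :: D :: B :: r) (D :: B :: r).
Proof.
  apply cs4_equivalent_of_interderivable; intros phi.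
  exact (closure_interior_idem _ (interior_Box Atom) (closure_Dia Atom)).
Qed.

Lemma reduce_NNN (Atom : Type) (r : modality) :
  cs4_equivalent Atom (N :: N :: N :: r) (N :: r).
Proof.
  apply cs4_equivalent_of_interderivable; intros phi; apply Neg_cube.
Qed.

Lemma reduce_BNNBN (Atom : Type) (r : modality) :
  cs4_equivalent Atom (B :: N :: N :: B :: N :: r) (B :: N :: r).
Proof.
  apply cs4_equivalent_of_interderivable; intros phi; apply Box_Neg_Neg_Box_Neg.
Qed.

Lemma reduce_NBNNB (Atom : Type) (r : modality) :
  cs4_equivalent Atom (N :: B :: N :: N :: B :: r) (N :: B :: r).
Proof.
  apply cs4_equivalent_of_interderivable; intros phi; apply Neg_Box_Neg_Neg_Box.
Qed.

Lemma reduce_BNBNBNB (Atom : Type) (r : modality) :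
  cs4_equivalent Atom (B :: N :: B :: N :: B :: N :: B :: r) (B :: N :: B :: r).
Proof.
  apply cs4_equivalent_of_interderivable; intros phi; apply Box_Neg_cube_open.
Qed.

Definition box_dia_words : list modality :=
  [[]; [B]; [D]; [B; D]; [D; B]; [B; D; B]; [D; B; D]].

(** Besides the four exceptional words, a reduced word is a core of one to three
    boxes separated by single negations, with up to two negations on each side. *)
Definition neg_box_words : list modality :=
  [[]; [N]; [N; N]; [B; N; N; B]] ++
  flat_map (fun l => flat_map (fun core => map (fun r => l ++ core ++ r)
      [[]; [N]; [N; N]])
      [[B]; [B; N; B]; [B; N; B; N; B]])
    [[]; [N]; [N; N]].

Ltac find_word :=
  simpl; repeat first [left; reflexivity | right].

Ltac reduce_with law :=
  solve [eexists; split; [|apply law]; find_word].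

Ltac already_reduced :=
  solve [eexists; split; [|intros ? ? ?; reflexivity]; find_word].

Lemma box_dia_words_cons_closed (Atom : Type) (o : modal_op) (t : modality) :
  o = OpBox \/ o = OpDia -> In t box_dia_words ->
  exists t', In t' box_dia_words /\ cs4_equivalent Atom (o :: t) t'.
Proof.
  intros Ho Ht; simpl in Ht.
  destruct Ho; subst o;
    repeat (destruct Ht as [Ht|Ht]; [subst t|]); try contradiction;
    first [ reduce_with reduce_BB | reduce_with reduce_DD
          | reduce_with reduce_BDBD | reduce_with reduce_DBDB
          | already_reduced ].
Qed.

Lemma neg_box_words_cons_closed (Atom : Type) (o : modal_op) (t : modality) :
  o = OpNeg \/ o = OpBox -> In t neg_box_words ->
  exists t', In t' neg_box_words /\ cs4_equivalent Atom (o :: t) t'.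
Proof.
  intros Ho Ht; simpl in Ht.
  destruct Ho; subst o;
    repeat (destruct Ht as [Ht|Ht]; [subst t|]); try contradiction;
    first [ reduce_with reduce_BB | reduce_with reduce_NNN
          | reduce_with reduce_BNNBN | reduce_with reduce_NBNNB
          | reduce_with reduce_BNBNBNB | already_reduced ].
Qed.

Theorem theorem6 (Atom : Type) :
  finitely_many_modalities Atom (fun o => o = OpBox \/ o = OpDia) /\
  finitely_many_modalities Atom (fun o => o = OpNeg \/ o = OpBox).
Proof.
  split.
  - apply (finitely_many_of_cons_closed (Sigma := box_dia_words)).
    + repeat (apply Forall_nil || apply Forall_cons); auto.
    + simpl; auto.
    + apply box_dia_words_cons_closed.
  - apply (finitely_many_of_cons_closed (Sigma := neg_box_words)).
    + unfold neg_box_words; simpl.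
      repeat (apply Forall_nil || apply Forall_cons); auto.
    + simpl; auto.
    + apply neg_box_words_cons_closed.
Qed.
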